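(* Let $\mathcal{E}=(\mathcal{U},\tilde\varphi,\mathcal{J})$ be a noncrossing exchangeability system for a noncommutative probability space $(\mathcal{A},\varphi)$ which satisfies the weak singleton condition and has a faithful state $\tilde\varphi$. Then for any selfadjoint random variable $X\in\mathcal{A}$ with $\tilde\varphi(X^{(1)}X^{(2)})=0$ the interchangeable sequence $X^{(i)}$ satisfies $$\Bigl\|\sum_{i=1}^N X^{(i)}\Bigr\|\le \frac{2\sqrt{N}}{1-\frac{1}{\sqrt N}}\,\|X\|$$ for every $N\ge 2$.
   Context: All algebras are unital complex $C^*$- or pre-$C^*$-algebras, and $\|\cdot\|$ is the $C^*$-norm. A noncommutative probability space is a pair $(\mathcal{A},\varphi)$ of such an algebra and a state $\varphi$ on it. Exchangeability system. An exchangeability system $\mathcal{E}=(\mathcal{U},\tilde\varphi,\mathcal{J})$ for $(\mathcal{A},\varphi)$ consists of a noncommutative probability space $(\mathcal{U},\tilde\varphi)$ and an infinite family $\mathcal{J}=(\iota_k)_{k\in\mathbf{N}}$ of state-preserving embeddings ($*$-homomorphisms with $\tilde\varphi\circ\iota_k=\varphi$) $\iota_k:\mathcal{A}\to\mathcal{A}_k\subseteq\mathcal{U}$, written $X\mapsto X^{(k)}$, such that for all $n$, $X_1,\dots,X_n\in\mathcal{A}$, $h:[n]\to\mathbf{N}$ (where $[n]=\{1,\dots,n\}$) and $\sigma\in\mathfrak{S}_\infty$ (permutations of $\mathbf{N}$) $$\tilde\varphi(X_1^{(h(1))}\cdots X_n^{(h(n))})=\tilde\varphi(X_1^{(\sigma(h(1)))}\cdots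 X_n^{(\sigma(h(n)))}).$$ It is assumed that $\mathcal{U}$ is generated by the algebras $\mathcal{A}_k$ and that the action $\sigma(X^{(k)})=X^{(\sigma(k))}$ of $\mathfrak{S}_\infty$ extends to all of $\mathcal{U}$ leaving $\tilde\varphi$ invariant. Cumulants. $\Pi_n$ is the lattice of set partitions of $[n]$ ($\pi\le\sigma$ means $\pi$ is finer than $\sigma$), with Möbius function $\mu$. For $\pi\in\Pi_n$, $\varphi_\pi(X_1,\dots,X_n)=\tilde\varphi(X_1^{(\pi(1))}\cdots X_n^{(\pi(n))})$, where $\pi(i)$ is the number of the block of $\pi$ containing $i$ (the numbering of the blocks is irrelevant), and $K^{\mathcal{E}}_\pi(X_1,\dots,X_n)=\sum_{\sigma\le\pi}\varphi_\sigma(X_1,\dots,X_n)\,\mu(\sigma,\pi)$. A partition is noncrossing if there are no $i<j<k<l$ with $i\sim k$, $j\sim l$, $i\not\sim j$. $\mathcal{E}$ is a noncrossing exchangeability system if $K^{\mathcal{E}}_\pi(X_1,\dots,X_n)=0$ for all $n$, all $X_i\in\mathcal{A}$ and all $\pi\in\Pi_n$ that are not noncrossing. Weak singleton condition. For all $n$, $X_1,\dots,X_n\in\mathcal{A}$ and indices $i_1,\dots,i_n\in\mathbf{N}$: $\tilde\varphi(X_1^{(i_1)}\cdots X_n^{(i_n)})=0$ whenever, for some $j$, the index $i_j$ appears only once among $i_1,\dots,i_n$ and $\tilde\varphi((X_j^{(1)})^*X_j^{(2)})=0$.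
   Formalization: The state on U is assumed faithful on the norm completion of U; for C*-algebras this is ordinary faithfulness, but for incomplete pre-C*-algebras ordinary faithfulness does not suffice (algebraic free product with the full norm gives N‖X‖, exceeding the bound at N = 10). *)

(* Defs.v *)
From HB Require Import structures.
From mathcomp Require Import all_boot all_order all_algebra.
From mathcomp Require Import complex ring.
From mathcomp Require Import all_reals.

Set Implicit Arguments.
Unset Strict Implicit.
Unset Printing Implicit Defensive.

Import Order.TTheory GRing.Theory Num.Theory.

Local Open Scope complex_scope.
Local Open Scope ring_scope.

(** * Pre-C*-algebras *)

(* The normed types of the library cannot be used here: Hierarchy Builder admits
   no structure joining normed spaces with rings that are not numeric domains.
   Completeness is not part of the structure, see [cstar_complete]. *)
HB.mixin Record Algebra_isPreCStar (R : realType) A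
    of GRing.Algebra R[i] A := {
  star : A -> A;
  cnorm : A -> R;
  starK : involutive star;
  starD : {morph star : x y / x + y};
  starZ : forall (a : R[i]) (x : A), star (a *: x) = conjc a *: star x;
  starM : forall x y : A, star (x * y) = star y * star x;
  cnorm_eq0 : forall x : A, cnorm x = 0 -> x = 0;
  cnormD : forall x y : A, cnorm (x + y) <= cnorm x + cnorm y;
  cnormZ : forall (a : R[i]) (x : A), (cnorm (a *: x))%:C = `|a| * (cnorm x)%:C;
  cnormM : forall x y : A, cnorm (x * y) <= cnorm x * cnorm y;
  cnorm_starM : forall x : A, cnorm (star x * x) = cnorm x ^+ 2
}.

#[short(type="preCStarAlgType")]
HB.structure Definition PreCStarAlgebra (R : realType) :=
  { A of GRing.Algebra R[i] A & Algebra_isPreCStar R A }.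

Section Metric.
Variables (R : realType) (A : preCStarAlgType R).

Definition cnorm_cvg (u : nat -> A) (a : A) : Prop :=
  forall e : R, 0 < e -> exists n0, forall n, (n0 <= n)%N -> cnorm (u n - a) < e.

Definition cnorm_cauchy (u : nat -> A) : Prop :=
  forall e : R, 0 < e -> exists n0, forall m n,
    (n0 <= m)%N -> (n0 <= n)%N -> cnorm (u m - u n) < e.

(* A pre-C*-algebra satisfying this is a C*-algebra. *)
Definition cstar_complete : Prop :=
  forall u : nat -> A, cnorm_cauchy u -> exists a, cnorm_cvg u a.

End Metric.
Arguments cstar_complete {R} A.

Section NormTheory.
Variables (R : realType) (A : preCStarAlgType R).
Implicit Types x y : A.

Lemma cnorm0 : cnorm (0 : A) = 0.
Proof.
have := cnormZ (0 : R[i]) (0 : A).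
by rewrite scale0r normr0 mul0r => /(congr1 (@complex.Re R)).
Qed.

Lemma cnormN x : cnorm (- x) = cnorm x.
Proof.
have := cnormZ (-1 : R[i]) x.
by rewrite scaleN1r normrN normr1 mul1r => /(congr1 (@complex.Re R)).
Qed.

Lemma cnorm_ge0 x : 0 <= cnorm x.
Proof.
have := cnormD x (- x); rewrite subrr cnorm0 cnormN -mulr2n.
by rewrite pmulrn_lge0.
Qed.

Lemma star0 : star (0 : A) = 0.
Proof. by apply: (@addrI _ (star 0)); rewrite -starD !addr0. Qed.

Lemma starN x : star (- x) = - star x.
Proof. by apply: (@addrI _ (star x)); rewrite -starD !subrr star0. Qed.

Lemma cnorm_star x : cnorm (star x) = cnorm x.
Proof.
suff h y : cnorm y <= cnorm (star y).
  by apply/eqP; rewrite eq_le h andbT -{2}(starK x) h.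
have := cnormM (star y) y; rewrite cnorm_starM expr2.
have := cnorm_ge0 y; rewrite le_eqVlt => /orP[/eqP <- _|y0].
  exact: cnorm_ge0.
by rewrite ler_pM2r.
Qed.

End NormTheory.

(** * States *)

Record is_state (R : realType) (A : preCStarAlgType R) (phi : {scalar A}) : Prop :=
  IsState {
    state_ge0 : forall a : A, 0 <= phi (star a * a);
    state1 : phi 1 = 1;
    state_le : forall a : A, `|phi a| <= (cnorm a)%:C
  }.

(* Faithfulness of the continuous extension of [phi] to the completion of [A],
   whose elements are the Cauchy sequences of [A] modulo null sequences.  On a
   C*-algebra this is the usual condition, see [faithful_stateP].  On an
   incomplete algebra the usual condition does not relate [phi] to the norm. *)
Definition faithful_state (R : realType) (A : preCStarAlgType R)
    (phi : {scalar A}) : Prop :=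
  forall u : nat -> A, cnorm_cauchy u ->
    (forall e : R, 0 < e -> exists n0, forall n, (n0 <= n)%N ->
       `|phi (star (u n) * u n)| < e%:C) ->
    cnorm_cvg u 0.

Lemma faithful_stateP (R : realType) (A : preCStarAlgType R) (phi : {scalar A}) :
  cstar_complete A -> is_state phi ->
  faithful_state phi <-> (forall a : A, phi (star a * a) = 0 -> a = 0).
Proof.
move=> cA [phi_ge0 _ phi_le]; split=> [fphi a phia0|fphi u cu phiu0].
  have {}fphi : cnorm_cvg (fun=> a) 0.
    apply: fphi => e e0; exists 0%N => *; first by rewrite subrr cnorm0.
    by rewrite phia0 normr0 ltcR.
  apply: cnorm_eq0; apply/eqP; rewrite eq_le cnorm_ge0 andbT leNgt.
  apply/negP => a0; have [n /(_ n (leqnn n))] := fphi _ a0.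
  by rewrite subr0 ltxx.
have [a ua] := cA u cu; suff a0 : a = 0 by rewrite a0 in ua.
apply: fphi; apply/eqP; rewrite -normr_eq0 eq_le normr_ge0 andbT.
set M := cnorm a + 1.
have M1 : 1 <= M by rewrite lerDr cnorm_ge0.
have M0 : 0 < M by apply: lt_le_trans M1.
suff small e : 0 < e -> `|phi (star a * a)| <= e%:C.
  have [p pE] : exists p : R, `|phi (star a * a)| = p%:C by case: (phi _) => x y; eexists.
  rewrite pE lecR leNgt; apply/negP => p0.
  have := small _ (divr_gt0 p0 (ltr0Sn _ 1)).
  by rewrite pE lecR ler_pdivlMr ?ltr0n // mulr_natr mulr2n gerDl leNgt p0.
move=> e0.
pose d := Num.min 1 (e / (4 * M)).
have d0 : 0 < d by rewrite lt_min ltr01 divr_gt0 ?mulr_gt0 ?ltr0n.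
have [n1 hn1] := ua _ d0.
have [n2 hn2] := phiu0 _ (divr_gt0 e0 (ltr0Sn _ 1)).
pose n := maxn n1 n2.
have {hn1}h1 := hn1 n (leq_maxl _ _); have {hn2}h2 := hn2 n (leq_maxr _ _).
set v := u n in h1 h2.
have -> : star a * a = star v * v - (star v * (v - a) + star (v - a) * a).
  by rewrite starD starN mulrBr mulrBl addrA subrK opprB addrC subrK.
rewrite linearB /=; apply: le_trans (ler_normB _ _) _.
rewrite [e in e%:C]splitr rmorphD /=; apply: lerD; first exact: ltW.
apply: le_trans (phi_le _) _; rewrite lecR.
apply: le_trans (cnormD _ _) _.
have hv : cnorm v <= M.
  rewrite -[v](subrK a) addrC; apply: le_trans (cnormD _ _) _.
  by rewrite lerD2l; apply/ltW/(lt_le_trans h1); rewrite ge_min lexx.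
have ha : cnorm a <= M by rewrite lerDl.
have hd : cnorm (v - a) <= e / (4 * M).
  by apply/ltW/(lt_le_trans h1); rewrite ge_min lexx orbT.
have -> : e / 2 = M * (e / (4 * M)) + e / (4 * M) * M.
  by field; rewrite gt_eqF.
by apply: lerD; apply: le_trans (cnormM _ _) _; rewrite ?cnorm_star;
   apply: ler_pM; rewrite ?cnorm_ge0.
Qed.

(** * The Möbius function of a finite poset *)

Section Mobius.
Context {d : Order.disp_t} {T : finPOrderType d}.
Implicit Types x y z : T.

Fixpoint mobius_rec (k : nat) x y : int :=
  if k is k'.+1 then
    if x == y then 1
    else if (x <= y)%O then
      - \sum_(z : T | (x <= z)%O && (z < y)%O) mobius_rec k' x z
    else 0
  else 0.

(* The recursion depth is at most the length of a chain, see [mobiusE]. *)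
Definition mobius x y : int := mobius_rec #|T| x y.

Lemma mobius_rec_stable k l x y :
  (#|[pred z | (z <= y)%O]| <= k)%N -> (#|[pred z | (z <= y)%O]| <= l)%N ->
  mobius_rec k x y = mobius_rec l x y.
Proof.
elim: k l y => [|k IH] [|l] y //=.
- by rewrite leqn0 => /eqP/card0_eq/(_ y); rewrite inE lexx.
- by move=> _; rewrite leqn0 => /eqP/card0_eq/(_ y); rewrite inE lexx.
move=> hk hl; case: eqP => // _; case: ifP => // _; congr (- _).
apply: eq_bigr => z /andP[_ zy].
suff lt_card : (#|[pred t | (t <= z)%O]| < #|[pred t | (t <= y)%O]|)%N.
  by apply: IH; rewrite -ltnS; apply: leq_trans lt_card _.
apply: proper_card; apply/properP; split.
  by apply/subsetP => t; rewrite !inE => /le_trans; apply; apply: ltW.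
by exists y; rewrite !inE ?lexx // lt_geF.
Qed.

Lemma mobiusE x y : mobius x y =
  if x == y then 1
  else if (x <= y)%O then - \sum_(z : T | (x <= z)%O && (z < y)%O) mobius x z
  else 0.
Proof.
rewrite /mobius (mobius_rec_stable (l := #|T|.+1)) ?leqW ?max_card //=.
Qed.

End Mobius.

(** * Set partitions *)

Record set_partition (n : nat) := SetPartition {
  blocks :> {set {set 'I_n}};
  blocksP : partition blocks [set: 'I_n]
}.

HB.instance Definition _ n := [isSub for @blocks n].
HB.instance Definition _ n := [Finite of set_partition n by <:].

Section SetPartition.
Variable n : nat.
Implicit Types p q r : set_partition n.

Definition same_block p (i j : 'I_n) : bool := pblock p i == pblock p j.

Definition finer p q : bool :=
  [forall B in blocks p, [exists C in blocks q, B \subset C]].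

Lemma finer_refl : reflexive finer.
Proof. by move=> p; apply/'forall_implyP => B pB; apply/exists_inP; exists B. Qed.

Lemma finer_trans : transitive finer.
Proof.
move=> q p r /'forall_implyP pq /'forall_implyP qr; apply/'forall_implyP => B pB.
have /exists_inP[C qC BC] := pq B pB; have /exists_inP[D rD CD] := qr C qC.
by apply/exists_inP; exists D => //; apply: subset_trans CD.
Qed.

Lemma finer_subset p q : finer p q -> finer q p -> blocks p \subset blocks q.
Proof.
move=> /'forall_implyP pq /'forall_implyP qp; apply/subsetP => B pB.
have /exists_inP[C qC BC] := pq B pB; have /exists_inP[D pD CD] := qp C qC.
have /and3P[_ /trivIsetP tI p0] := blocksP p.
have BD : B = D.
  apply/eqP; apply: contraNT p0 => /(tI B D pB pD).
  rewrite -setI_eq0 => /eqP BD0.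
  suff -> : set0 = B by [].
  by apply/esym/eqP; rewrite -subset0 -BD0 subsetI subxx (subset_trans BC CD).
by rewrite (_ : B = C) //; apply/eqP; rewrite eqEsubset BC BD CD.
Qed.

Lemma finer_anti : antisymmetric finer.
Proof.
move=> p q /andP[pq qp]; apply/val_inj/eqP.
by rewrite eqEsubset !finer_subset.
Qed.

Definition crossing p : bool :=
  [exists i : 'I_n, exists j : 'I_n, exists k : 'I_n, exists l : 'I_n,
    [&& (i < j < k)%N, (k < l)%N, same_block p i k, same_block p j l
      & ~~ same_block p i j]].

Definition noncrossing p : bool := ~~ crossing p.

(* A numbering of the blocks. *)
Definition block_number p (i : 'I_n) : nat := index (pblock p i) (enum (blocks p)).

End SetPartition.

Fact finer_display : Order.disp_t. Proof. exact: Order.Disp tt tt. Qed.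

HB.instance Definition _ n :=
  Order.Le_isPOrder.Build finer_display (set_partition n)
    (@finer_refl n) (@finer_anti n) (@finer_trans n).

(** * Exchangeability systems *)

Record exchangeability_system (R : realType) (A : preCStarAlgType R)
    (phi : {scalar A}) := ExchangeabilitySystem {
  exch_alg : preCStarAlgType R;
  exch_state : {scalar exch_alg};
  exch_stateP : is_state exch_state;
  emb : nat -> {lrmorphism A -> exch_alg};
  emb_inj : forall k, injective (emb k);
  emb_star : forall k X, emb k (star X) = star (emb k X);
  emb_state : forall k X, exch_state (emb k X) = phi X;
  exchangeable : forall (n : nat) (X : 'I_n -> A) (h : 'I_n -> nat)
      (s : nat -> nat), bijective s ->
    exch_state (\prod_(i < n) emb (h i) (X i)) =
    exch_state (\prod_(i < n) emb (s (h i)) (X i));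
  (* Topological generation, which algebraic generation implies. *)
  emb_generate : forall S : exch_alg -> Prop,
    S 1 -> (forall x y, S x -> S y -> S (x + y)) ->
    (forall (a : R[i]) x, S x -> S (a *: x)) ->
    (forall x y, S x -> S y -> S (x * y)) ->
    (forall x, S x -> S (star x)) ->
    (forall u x, (forall n, S (u n)) -> cnorm_cvg u x -> S x) ->
    (forall k X, S (emb k X)) ->
    forall x, S x;
  exch_action : exists act : (nat -> nat) -> {lrmorphism exch_alg -> exch_alg},
    [/\ forall x, act id x = x,
        forall s t, bijective s -> bijective t ->
          forall x, act (s \o t) x = act s (act t x),
        forall s, bijective s -> forall x, act s (star x) = star (act s x),
        forall s, bijective s -> forall k X, act s (emb k X) = emb (s k) X
      & forall s, bijective s -> forall x, exch_state (act s x) = exch_state x]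
}.

Section Cumulants.
Variables (R : realType) (A : preCStarAlgType R) (phi : {scalar A}).
Variable E : exchangeability_system phi.

Definition partitioned_moment (n : nat) (p : set_partition n) (X : 'I_n -> A) : R[i] :=
  exch_state E (\prod_(i < n) emb E (block_number p i) (X i)).

Definition partitioned_cumulant (n : nat) (p : set_partition n) (X : 'I_n -> A) : R[i] :=
  \sum_(q : set_partition n | (q <= p)%O) partitioned_moment q X * (mobius q p)%:~R.

Definition noncrossing_system : Prop :=
  forall (n : nat) (X : 'I_n -> A) (p : set_partition n),
    ~~ noncrossing p -> partitioned_cumulant p X = 0.

Definition weak_singleton_condition : Prop :=
  forall (n : nat) (X : 'I_n -> A) (h : 'I_n -> nat) (j : 'I_n),
    (forall k, h k = h j -> k = j) ->
    exch_state E (star (emb E 1 (X j)) * emb E 2 (X j)) = 0 ->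
    exch_state E (\prod_(i < n) emb E (h i) (X i)) = 0.

End Cumulants.

(* Main.v *)
Require Import Defs.
From HB Require Import structures.
From mathcomp Require Import all_boot all_order all_algebra.
From mathcomp Require Import complex ring lra.
From mathcomp Require Import all_reals.

Set Implicit Arguments.
Unset Strict Implicit.
Unset Printing Implicit Defensive.

Import Order.TTheory GRing.Theory Num.Theory.

Local Open Scope complex_scope.
Local Open Scope ring_scope.

(** Write [S] for the sum of the [N] copies of [X] and [t] for the square root
    of [N].  The stronger bound [cnorm S <= (1 + 2 * t) * cnorm X] holds, by the
    moment method.

    _Combinatorics._  Expand the [n]th moment of [S] over the words [w] of length
    [n] in [N] letters.  By Moebius inversion, the moment of the copies of [X]
    along [w] is the sum of the cumulants over the partitions [p] of the positions
    such that [w] is constant on the blocks of [p].  The cumulants of crossing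
    partitions vanish, and so do those of partitions with a singleton, because
    [X] is centered and all partitions below such a partition have the same
    singleton.  Hence [w] contributes only if it is constant on the blocks of a
    noncrossing partition without singletons ([moment_neq0_noncrossing]).  Such a
    word is accepted by a pushdown automaton whose stack holds the colours of the
    blocks that are currently open ([stack_accepts_partition]).  Its runs are
    Motzkin paths with weight [N] on the up steps and [1] on the others, so that
    at most [(1 + 2 * t) ^+ n] words are accepted ([word_sum_accepts]).  Every
    word contributes at most [cnorm X ^+ n].

    _From moments to the norm._  If the moments of a selfadjoint [T] under a
    faithful state are at most [M ^+ n], then [cnorm T <= M]
    ([cnorm_le_of_moments]).  With spectral theory this is clear: the spectral
    measure of [T] lives on [[- M, M]], so the state kills every function of [T]
    vanishing there, and faithfulness says that this function is zero.  The same
    argument works in a pre-C*-algebra with a single function, the positive part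
    of a polynomial in [T], which only needs square roots.  The iteration
    [y |-> (x + y ^+ 2) / 2] approximates [1 - sqrt (1 - x)] as soon as
    [cnorm x <= 1], with explicit rates; the C*-identity, applied to [p + i q],
    gives the order properties ([cnorm_le_sum_sqr], [cnorm_1Bsqr_le1]).  The
    approximations of the positive part form a Cauchy sequence, which is what
    faithfulness on the completion asks for.

    The second part is used twice: also to see that the embeddings do not
    increase the norm of selfadjoint elements ([cnorm_emb]). *)

(** * Norm and involution *)

Section PreCStar.
Variables (R : realType) (A : preCStarAlgType R).
Implicit Types (x y a p q : A) (r : R).

Lemma cnormB x y : cnorm (x - y) <= cnorm x + cnorm y.
Proof. by rewrite -(cnormN y) cnormD. Qed.

Lemma cnormZr r x : cnorm (r%:C *: x) = `|r| * cnorm x.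
Proof.
have := cnormZ r%:C x; rewrite normc_def /= expr0n addr0 sqrtr_sqr -rmorphM.
by move=> /(congr1 (@complex.Re R)).
Qed.

Lemma cnormMn x n : cnorm (x *+ n) = n%:R * cnorm x.
Proof.
have -> : x *+ n = (n%:R : R)%:C *: x by rewrite rmorph_nat scaler_nat.
by rewrite cnormZr normr_nat.
Qed.

Lemma starZr r x : star (r%:C *: x) = r%:C *: star x.
Proof. by rewrite starZ /= oppr0. Qed.

Lemma starMn x n : star (x *+ n) = star x *+ n.
Proof. by elim: n => [|n IH]; rewrite ?mulr0n ?star0 // !mulrS starD IH. Qed.

Lemma starB x y : star (x - y) = star x - star y.
Proof. by rewrite starD starN. Qed.

Lemma star1 : star (1 : A) = 1.
Proof. by rewrite -[LHS]mulr1 -[in X in _ * X](starK (1 : A)) -starM mulr1 starK. Qed.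

Lemma starX x n : star (x ^+ n) = star x ^+ n.
Proof. by elim: n => [|n IH]; rewrite ?star1 // exprS starM IH -exprSr. Qed.

Lemma cnorm1_le1 : cnorm (1 : A) <= 1.
Proof.
have := cnorm_starM (1 : A); rewrite star1 mulr1 expr2 => h.
have := cnorm_ge0 (1 : A); rewrite le_eqVlt => /orP[/eqP <- //|n0].
by rewrite -(ler_pM2l n0) mulr1 -h.
Qed.

Lemma cnormM_le x y (c d : R) : cnorm x <= c -> cnorm y <= d -> cnorm (x * y) <= c * d.
Proof. by move=> hx hy; apply: le_trans (cnormM _ _) _; rewrite ler_pM ?cnorm_ge0. Qed.

Lemma cnormX x n : cnorm (x ^+ n) <= cnorm x ^+ n.
Proof.
elim: n => [|n IH]; first by rewrite !expr0 cnorm1_le1.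
by rewrite !exprS; apply: cnormM_le.
Qed.

Lemma cnorm_sa_sqr a : star a = a -> cnorm (a ^+ 2) = cnorm a ^+ 2.
Proof. by move=> sa; rewrite -cnorm_starM sa. Qed.

(** The element [v = p + i q] satisfies [star v * v = p ^+ 2 + q ^+ 2], and [p] is
    its real part.  In the absence of a functional calculus this is how upper
    bounds on norms are obtained below: complete [p ^+ 2] to a scalar. *)
Lemma cnorm_le_sum_sqr p q : star p = p -> star q = q -> GRing.comm p q ->
  cnorm p ^+ 2 <= cnorm (p ^+ 2 + q ^+ 2).
Proof.
move=> sp sq cpq; pose v := p + 'i%C *: q.
have sv : star v = p - 'i%C *: q.
  rewrite starD starZ sp sq; congr (_ + _); rewrite -scaleNr; congr (_ *: _).
  by apply/eqP; rewrite eq_complex /= oppr0 !eqxx.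
have vv : star v * v = p ^+ 2 + q ^+ 2.
  rewrite sv mulrDr !mulrBl -!scalerAr -!scalerAl scalerA -(expr2 'i%C) sqr_i cpq.
  by rewrite scaleN1r opprK addrA subrK.
rewrite -vv cnorm_starM ler_pXn2r ?nnegrE ?cnorm_ge0 //.
have := cnormD v (star v); rewrite cnorm_star.
have -> : v + star v = p *+ 2 by rewrite sv addrACA subrr addr0 -mulr2n.
by rewrite cnormMn mulr_natl -[X in _ <= X]mulr2n ler_pMn2r.
Qed.

End PreCStar.

(** * Square roots by iteration *)

Lemma le0_harmonic (R : realType) (t c : R) : (forall k, t <= c / k.+2%:R) -> t <= 0.
Proof.
move=> h; rewrite leNgt; apply/negP => t0.
have c0 : 0 < c.
  by have := lt_le_trans t0 (h 0%N); rewrite pmulr_lgt0 ?invr_gt0 ?ltr0n.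
have := archi_boundP (ltW (divr_gt0 c0 t0)); set k := Num.Def.archi_bound _ => hk.
have := h k; rewrite ler_pdivlMr ?ltr0n // leNgt => /negP; apply.
rewrite -ltr_pdivrMl // mulrC; apply: lt_le_trans hk _.
by rewrite ler_nat -addn2 leq_addr.
Qed.

(** The iteration [sqrt_step] below at the scalar [x = 1], where it increases to
    [1]. *)
Fixpoint unit_step (R : realType) (k : nat) : R :=
  if k is k'.+1 then (1 + unit_step R k' ^+ 2) / 2 else 0.

(** The defect [d = 1 - unit_step R k] evolves by [d |-> d - d ^+ 2 / 2], so it
    decays like [2 / k]. *)
Lemma unit_step_bounds (R : realType) k :
  [/\ 0 <= unit_step R k, unit_step R k <= 1 & 1 - unit_step R k <= 2 / k.+2%:R].
Proof.
elim: k => [|k [h0 h1 h2]] /=; first by rewrite lexx ler01 subr0 divff ?pnatr_eq0.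
set e := unit_step R k in h0 h1 h2 *; split; [nra|nra|].
have z2 : 2 <= k.+2%:R :> R by rewrite ler_nat.
have -> : k.+3%:R = k.+2%:R + 1 :> R by rewrite natr1.
set z := k.+2%:R in h2 z2 *.
have z0 : 0 < z by apply: lt_le_trans z2.
have {h2} : (1 - e) * z <= 2 by rewrite -ler_pdivlMr.
rewrite ler_pdivlMr; last by rewrite ltr_wpDr.
have -> : 1 - (1 + e ^+ 2) / 2 = (1 - e) - (1 - e) ^+ 2 / 2 by field.
have : 0 <= 1 - e by rewrite subr_ge0.
have : 1 - e <= 1 by rewrite lerBlDr lerDl.
move: (1 - e) => d d1 d0 dz.
have [|dz1] := leP (d * (z + 1)) 2; nra.
Qed.

Lemma sqr_1B (B : pzRingType) (y : B) : (1 - y) ^+ 2 = 1 - y *+ 2 + y ^+ 2.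
Proof. by rewrite -opprB sqrrN sqrrB1 addrC addrA addrAC. Qed.

Lemma harmonic_small (R : realType) (c e : R) : 0 < e ->
  exists n0, forall n, (n0 <= n)%N -> c / n.+2%:R < e.
Proof.
move=> e0; exists (Num.Def.archi_bound (`|c| / e)) => n hn.
rewrite ltr_pdivrMr ?ltr0n // mulrC -ltr_pdivrMr //.
apply: le_lt_trans (ler_norm _) _; rewrite normrM [`|e^-1|]gtr0_norm ?invr_gt0 //.
apply: lt_le_trans (archi_boundP _) _; first by rewrite divr_ge0 // ltW.
by rewrite ler_nat (leq_trans hn) // -addn2 leq_addr.
Qed.

Section SqrtIteration.
Variables (R : realType) (A : preCStarAlgType R) (x : A).

(** The limit is [1 - sqrt (1 - x)].  The steps are polynomials in [x] with
    nonnegative coefficients, hence the values at [x = 1] dominate the norms for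
    [cnorm x <= 1]: this replaces the power series of the square root. *)
Fixpoint sqrt_step (k : nat) : A :=
  if k is k'.+1 then (2^-1 : R)%:C *: (x + sqrt_step k' ^+ 2) else 0.

Definition sqrt_approx k := 1 - sqrt_step k.

Lemma sqrt_stepS2 k : sqrt_step k.+1 *+ 2 = x + sqrt_step k ^+ 2.
Proof.
rewrite /= -scaler_nat scalerA -(rmorph_nat (real_complex R) 2%N) -rmorphM.
by rewrite divff ?pnatr_eq0 // scale1r.
Qed.

Lemma sqrt_approx_comm z k : GRing.comm z x -> GRing.comm z (sqrt_approx k).
Proof.
move=> zx; apply: commrB; first exact: commr1.
elim: k => [|k IH]; first exact: commr0.
by rewrite /GRing.comm /= -scalerAl -scalerAr (commrD zx (commrX 2 IH)).
Qed.

Lemma sqrt_approx_star k : star x = x -> star (sqrt_approx k) = sqrt_approx k.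
Proof.
move=> sx; rewrite starB star1; congr (_ - _).
elim: k => [|k IH]; first exact: star0.
by rewrite starZr starD starX IH sx.
Qed.

(** The increments of the iteration measure how far the approximation is from a
    square root. *)
Lemma sqrt_approx_sqr k :
  sqrt_approx k ^+ 2 = 1 - x + (sqrt_step k.+1 - sqrt_step k) *+ 2.
Proof.
by rewrite mulrnBl sqrt_stepS2 /sqrt_approx sqr_1B addrA addrA subrK addrAC.
Qed.

Hypothesis x1 : cnorm x <= 1.

Lemma sqrt_step_le k : cnorm (sqrt_step k) <= unit_step R k.
Proof.
elim: k => [|k IH] /=; first by rewrite cnorm0.
rewrite cnormZr ger0_norm ?invr_ge0 ?ler0n // mulrC ler_pM2r ?invr_gt0 ?ltr0n //.
apply: le_trans (cnormD _ _) (lerD x1 _).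
by rewrite expr2 expr2; apply: cnormM_le.
Qed.

(** A difference of squares [a ^+ 2 - b ^+ 2] is [a (a - b) + (a - b) b], so
    the increment at [x] is dominated by the increment at [1]. *)
Lemma sqrt_stepB_le k :
  cnorm (sqrt_step k.+1 - sqrt_step k) <= unit_step R k.+1 - unit_step R k.
Proof.
have halfP (u : R) : cnorm (sqrt_step k.+1 - sqrt_step k) *+ 2 <= u *+ 2 ->
  cnorm (sqrt_step k.+1 - sqrt_step k) <= u by rewrite ler_pMn2r.
apply: halfP; rewrite -mulr_natl -cnormMn mulrnBl.
elim: k => [|k IH].
  rewrite sqrt_stepS2 /= !expr0n !addr0 mul0rn !subr0 -[X in _ <= X]mulr_natr.
  by rewrite divfK ?pnatr_eq0.
rewrite !sqrt_stepS2 opprD addrACA subrr add0r.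
set a := sqrt_step k.+1; set b := sqrt_step k.
have -> : a ^+ 2 - b ^+ 2 = a * (a - b) + (a - b) * b.
  by rewrite mulrBr mulrBl addrA subrK.
have ab : cnorm (a - b) <= unit_step R k.+1 - unit_step R k.
  by move: IH; rewrite -mulrnBl cnormMn mulr_natl ler_pMn2r.
apply: le_trans (cnormD _ _) _.
apply: le_trans (lerD (cnormM_le (sqrt_step_le _) ab) (cnormM_le ab (sqrt_step_le _))) _.
rewrite le_eqVlt; apply/orP; left; apply/eqP => /=; set e := unit_step R k.
by rewrite -mulr_natr; field.
Qed.

Lemma sqrt_approx_cauchy k m : (k <= m)%N ->
  cnorm (sqrt_approx m - sqrt_approx k) <= 2 / k.+2%:R.
Proof.
move=> km.
suff h : cnorm (sqrt_approx m - sqrt_approx k) <= unit_step R m - unit_step R k.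
  apply: le_trans h _; have [_ _ h] := unit_step_bounds R k.
  by have [_ m1 _] := unit_step_bounds R m; apply: le_trans h; rewrite lerD2r.
rewrite /sqrt_approx opprB addrC addrA subrK -cnormN opprB.
elim: m km => [|m IH]; first by rewrite leqn0 => /eqP ->; rewrite !subrr cnorm0.
rewrite leq_eqVlt => /orP[/eqP <-|/IH h]; first by rewrite !subrr cnorm0.
rewrite -[X in cnorm (X - _)](subrK (sqrt_step m)) -addrA.
apply: le_trans (cnormD _ _) _; apply: le_trans (lerD (sqrt_stepB_le _) h) _.
by rewrite addrA subrK.
Qed.

Lemma sqrt_approx_sqr_le k :
  cnorm (sqrt_approx k ^+ 2 - (1 - x)) <= 4 / k.+2%:R.
Proof.
rewrite sqrt_approx_sqr addrC addKr cnormMn.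
have -> : sqrt_step k.+1 - sqrt_step k = - (sqrt_approx k.+1 - sqrt_approx k).
  by rewrite /sqrt_approx !opprB [RHS]addrC addrA subrK.
rewrite cnormN; have -> : 4 / k.+2%:R = 2%:R * (2 / k.+2%:R) :> R by rewrite mulrA -natrM.
by rewrite ler_pM2l ?ltr0n // sqrt_approx_cauchy.
Qed.

Lemma sqrt_step_le1 k : cnorm (1 - sqrt_approx k) <= 1.
Proof.
rewrite /sqrt_approx opprB addrC subrK.
by apply: le_trans (sqrt_step_le k) _; have [] := unit_step_bounds R k.
Qed.

End SqrtIteration.

(** * Order properties *)

Section Positivity.
Variables (R : realType) (A : preCStarAlgType R).
Implicit Types (x y a p q : A) (r : R).

(** With [a] in the role of [sin u], this bounds [cos (2 u) = 1 - 2 a ^+ 2], whose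
    square is completed to [1] by that of [sin (2 u) = 2 a sqrt (1 - a ^+ 2)]. *)
Lemma cnorm_1B2sqr_le1 a : star a = a -> cnorm a <= 1 -> cnorm (1 - a ^+ 2 *+ 2) <= 1.
Proof.
move=> sa a1; have a21 : cnorm (a ^+ 2) <= 1.
  by rewrite cnorm_sa_sqr // expr_le1 // cnorm_ge0.
rewrite -(@ler_pXn2r _ 2) ?nnegrE ?cnorm_ge0 // expr1n -subr_le0.
apply: (@le0_harmonic _ _ (4 * 4)) => k.
pose s := sqrt_approx (a ^+ 2) k.
have cas : GRing.comm a s by apply: sqrt_approx_comm; apply/commrX.
have cs2 : GRing.comm (a ^+ 2) s by apply: sqrt_approx_comm.
have ss : star s = s by apply: sqrt_approx_star; rewrite starX sa.
pose p := 1 - a ^+ 2 *+ 2; pose q := (a * s) *+ 2.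
have sp : star p = p by rewrite starB star1 starMn starX sa.
have sq : star q = q by rewrite /q starMn starM ss sa cas.
have cpq : GRing.comm p q.
  apply/commr_sym/commrB; first exact: commr1.
  apply/commrMn/commrX/commr_sym/commrMn/commrM => //.
have pq : p ^+ 2 + q ^+ 2 = 1 + (a ^+ 2 * (s ^+ 2 - (1 - a ^+ 2))) *+ 4.
  rewrite /p /q sqr_1B !exprMn_n -mulrnA exprMn_comm // !mulrBr mulr1 -expr2.
  rewrite opprB mulrnDl mulrnBl -[(2 * 2)%N]/4%N -[(2 ^ 2)%N]/4%N.
  move: (a ^+ 2 *+ 4) (a ^+ 2 ^+ 2 *+ 4) (a ^+ 2 * s ^+ 2 *+ 4) => u v w.
  by rewrite -!addrA; congr (1 + _); rewrite addrC addrAC addrC.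
rewrite lerBlDr; apply: le_trans (cnorm_le_sum_sqr sp sq cpq) _.
rewrite pq addrC; apply: le_trans (cnormD _ _) _; apply: lerD; last exact: cnorm1_le1.
rewrite cnormMn -mulrA; apply: ler_wpM2l => //; rewrite -[X in _ <= X]mul1r.
by apply: cnormM_le => //; apply: sqrt_approx_sqr_le.
Qed.

(** This is the positivity of [a ^+ 2], in a form that lets [1 - a ^+ 2] enter
    the square root iteration, which then approximates the absolute value of
    [a]. *)
Lemma cnorm_1Bsqr_le1 a : star a = a -> cnorm a <= 1 -> cnorm (1 - a ^+ 2) <= 1.
Proof.
move=> sa a1; rewrite -(@ler_pMn2r _ 2) // -[X in X <= _]mulr_natl -cnormMn mulrnBl.
rewrite mulr2n -addrA; apply: le_trans (cnormD _ _) (lerD (cnorm1_le1 _) _).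
exact: cnorm_1B2sqr_le1.
Qed.

End Positivity.

(** * States *)

(** Above the fixed point [d / (rho - 1)] of the recursion the sequence [g] would
    grow geometrically. *)
Lemma bounded_affine_growth (R : realType) (g : nat -> R) (rho d C : R) :
  1 < rho -> (forall m, rho * g m - d <= g m.+1) -> (forall m, g m <= C) ->
  g 0%N <= d / (rho - 1).
Proof.
move=> rho1 gS gC; have r0 : 0 < rho - 1 by rewrite subr_gt0.
rewrite leNgt; apply/negP; rewrite -subr_gt0; set u := _ - _ => u0.
(* Bernoulli's inequality is all that is used of the growth. *)
have grow m : u + m%:R * ((rho - 1) * u) <= g m - d / (rho - 1).
  elim: m => [|m IH]; first by rewrite mul0r addr0.
  have -> : g m.+1 - d / (rho - 1) =
      (g m.+1 - (rho * g m - d)) + rho * (g m - d / (rho - 1)).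
    by field; rewrite gt_eqF.
  have := gS m; rewrite -subr_ge0; set w := _ - _ => w0.
  have um : u <= g m - d / (rho - 1).
    by apply: le_trans IH; rewrite lerDl !mulr_ge0 // ltW.
  rewrite -natr1; move: (g m - _) IH um => v IH um.
  have : (rho - 1) * u <= (rho - 1) * v by rewrite ler_pM2l.
  nra.
have c0 : 0 < (rho - 1) * u by rewrite mulr_gt0.
have bnd m : m%:R * ((rho - 1) * u) <= C - d / (rho - 1).
  have := grow m; have := gC m; lra.
have := archi_boundP (divr_ge0 (le_trans (mulr_ge0 (ler0n _ 0) (ltW c0)) (bnd 0%N)) (ltW c0)).
by rewrite ltr_pdivrMr // ltNge bnd.
Qed.

Lemma sqrD_comm (B : pzRingType) (x y : B) : GRing.comm x y ->
  (x + y) ^+ 2 = x ^+ 2 + (x * y) *+ 2 + y ^+ 2.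
Proof. by move=> cxy; rewrite !expr2 mulrDl !mulrDr -cxy mulr2n !addrA. Qed.

Section State.
Variables (R : realType) (B : preCStarAlgType R) (phi : {scalar B}).
Hypothesis phi_state : is_state phi.
Implicit Types (x y z s : B).

(** Moments of selfadjoint elements are real, so that taking real parts loses
    nothing. *)
Definition re_state x : R := complex.Re (phi x).
Local Notation psi := re_state.

Lemma re_stateD x y : psi (x + y) = psi x + psi y.
Proof. by rewrite /re_state linearD; case: (phi x) (phi y) => ? ? []. Qed.

Lemma re_stateN x : psi (- x) = - psi x.
Proof. by rewrite /re_state linearN; case: (phi x). Qed.

Lemma re_stateZ (r : R) x : psi (r%:C *: x) = r * psi x.
Proof. by rewrite /re_state linearZ /=; case: (phi x) => u v /=; rewrite mul0r subr0. Qed.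

Lemma re_stateMn x n : psi (x *+ n) = psi x *+ n.
Proof. by elim: n => [|n IH]; rewrite ?mulr0n ?mulrS ?re_stateD ?IH // /re_state linear0. Qed.

Lemma re_state_norm x : `|psi x| <= cnorm x.
Proof.
rewrite -lecR; apply: le_trans (state_le phi_state x); exact: normc_ge_Re.
Qed.

Lemma state_sqrE x : phi (star x * x) = (psi (star x * x))%:C.
Proof.
have := state_ge0 phi_state x; rewrite /re_state lecE /= => /andP[/eqP h _].
by case: (phi _) h => u v /= ->.
Qed.

Lemma re_state_sqr_ge0 x : 0 <= psi (star x * x).
Proof. by rewrite -lecR -state_sqrE state_ge0. Qed.

Lemma re_state_sa_sqr_ge0 x : star x = x -> 0 <= psi (x ^+ 2).
Proof. by move=> sx; have := re_state_sqr_ge0 x; rewrite sx. Qed.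

(** The Cauchy-Schwarz inequality for commuting selfadjoint elements, from the
    positivity of the squares of [x + y] and [x - y], where [y] is [z] rescaled to
    norm [1]. *)
Lemma re_state_mul_le x z : star x = x -> star z = z -> GRing.comm x z ->
  psi (x ^+ 2) <= 1 -> `|psi (x * z)| <= cnorm z.
Proof.
move=> sx sz cxz x1.
have amgm y : star y = y -> GRing.comm x y -> `|psi (x * y)| *+ 2 <= psi (x ^+ 2) + psi (y ^+ 2).
  move=> sy cxy; rewrite -normrMn ler_norml -re_stateMn; apply/andP; split.
    rewrite -subr_ge0 opprK addrCA addrA -!re_stateD -sqrD_comm //.
    by rewrite re_state_sa_sqr_ge0 // starD sx sy.
  rewrite -subr_ge0 addrAC -re_stateN -mulNrn -mulrN -(sqrrN y) -!re_stateD.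
  rewrite -sqrD_comm; last exact: commrN.
  by rewrite re_state_sa_sqr_ge0 // starB sx sy.
have := cnorm_ge0 z; rewrite le_eqVlt => /orP[/eqP z0|z0].
  by rewrite (cnorm_eq0 _ (esym z0)) mulr0 cnorm0 /re_state linear0 normr0.
set e := cnorm z in z0 *.
pose y := (e^-1)%:C *: z.
have zE : z = e%:C *: y by rewrite scalerA -rmorphM mulfV ?gt_eqF // scale1r.
have sy : star y = y by rewrite starZr sz.
have cxy : GRing.comm x y by rewrite /GRing.comm -scalerAl -scalerAr cxz.
have y1 : cnorm y = 1 by rewrite cnormZr gtr0_norm ?invr_gt0 // mulVf ?gt_eqF.
have y2 : psi (y ^+ 2) <= 1.
  by apply: le_trans (ler_norm _) (le_trans (re_state_norm _) _); rewrite cnorm_sa_sqr // y1 expr1n.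
rewrite zE -scalerAr re_stateZ normrM gtr0_norm // -[X in _ <= X]mulr1 ler_pM2l //.
rewrite -(@ler_pMn2r _ 2) //; apply: le_trans (amgm y sy cxy) _.
by rewrite mulr2n lerD.
Qed.

(** The element [s] is approximately the square of a selfadjoint element, as
    [cnorm (1 - s) <= 1]. *)
Lemma re_state_conj_ge0 s z : cnorm (1 - s) <= 1 -> star s = s ->
  0 <= psi (star z * s * z).
Proof.
move=> s1 ss; rewrite -oppr_le0; apply: (@le0_harmonic _ _ (4 * cnorm z ^+ 2)) => k.
pose r := sqrt_approx (1 - s) k.
have sr : star r = r by apply: sqrt_approx_star; rewrite starB star1 ss.
have rs : cnorm (s - r ^+ 2) <= 4 / k.+2%:R.
  have := sqrt_approx_sqr_le s1 k; rewrite -/r -cnormN !opprB.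
  by rewrite addrCA subrr addr0.
clearbody r.
have -> : star z * s * z = star (r * z) * (r * z) + star z * (s - r ^+ 2) * z.
  by rewrite starM sr mulrBr mulrBl expr2 !mulrA [RHS]addrC subrK.
rewrite re_stateD opprD -[X in _ <= X]add0r; apply: lerD.
  by rewrite oppr_le0 re_state_sqr_ge0.
apply: le_trans (ler_norm _) _; rewrite normrN.
apply: le_trans (re_state_norm _) _.
apply: le_trans (cnormM_le (cnormM_le (lexx _) rs) (lexx _)) _.
by rewrite cnorm_star expr2 le_eqVlt; apply/orP; left; apply/eqP; ring.
Qed.

End State.

(** * The norm is determined by the moments under a faithful state *)

(** Let the even moments of [T] be at most [1].  Under the state, [T] behaves as
    if its spectrum were contained in [[-1, 1]], so that the positive part of
    [T ^+ 2 - rho] is negligible for [rho > 1].  Here [a] is [T ^+ 2 - rho],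
    rescaled to norm at most [1], and [s k] approximates its absolute value, the
    square root of [a ^+ 2]; thus [excess k] approximates twice the positive part
    of [a]. *)
Section Faithful.
Variables (R : realType) (B : preCStarAlgType R) (phi : {scalar B}).
Hypothesis phi_state : is_state phi.
Variable T : B.
Hypothesis sT : star T = T.
Hypothesis T_moments : forall m, re_state phi (T ^+ (2 * m)) <= 1.
Variable rho : R.
Hypothesis rho1 : 1 < rho.
Local Notation psi := (re_state phi).

(* The scale of [a] is a square, as its root enters [cnorm_sqr_le_of_faithful]. *)
Let l := cnorm T + rho.
Let a : B := ((l ^+ 2)^-1)%:C *: (T ^+ 2 - rho%:C *: 1).
Let s k := sqrt_approx (1 - a ^+ 2) k.
Definition excess k := s k + a.

Let l0 : 0 < l.
Proof. by rewrite ltr_wpDl ?cnorm_ge0 // (lt_trans ltr01). Qed.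

Let TTE : T ^+ 2 = rho%:C *: 1 + (l ^+ 2)%:C *: a.
Proof.
rewrite /a scalerA -rmorphM mulfV ?expf_neq0 ?gt_eqF // scale1r.
by rewrite addrC subrK.
Qed.

Let sa : star a = a.
Proof. by rewrite starZr starB starX sT starZr star1. Qed.

Let a1 : cnorm a <= 1.
Proof.
rewrite cnormZr gtr0_norm ?invr_gt0 ?exprn_gt0 // ler_pdivrMl ?exprn_gt0 // mulr1.
apply: le_trans (cnormB _ _) _; rewrite cnorm_sa_sqr // cnormZr.
have r0 : 0 < rho by apply: lt_trans rho1.
rewrite gtr0_norm // /l sqrrD -addrA lerD2l.
apply: (@le_trans _ _ (rho ^+ 2)); last by rewrite lerDr mulrn_wge0 // mulr_ge0 ?cnorm_ge0 // ltW.
by rewrite expr2 ler_pM2l // (le_trans (cnorm1_le1 B)) // ltW.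
Qed.

Let a21 : cnorm (1 - a ^+ 2) <= 1.
Proof. exact: cnorm_1Bsqr_le1. Qed.

Let comm_s z k : GRing.comm z a -> GRing.comm z (s k).
Proof.
by move=> za; apply: sqrt_approx_comm; apply: commrB; [apply: commr1|apply: commrX].
Qed.

Let comm_Ta : GRing.comm T a.
Proof.
rewrite /GRing.comm /a -scalerAl -scalerAr mulrBl mulrBr.
by rewrite -!scalerAr -!scalerAl mul1r mulr1 -exprS -exprSr.
Qed.

Let ss k : star (s k) = s k.
Proof. by apply: sqrt_approx_star; rewrite starB star1 starX sa. Qed.

Let s2 k : cnorm (s k) <= 2.
Proof.
rewrite -(subKr 1 (s k)); apply: le_trans (cnormB _ _) _.
by apply: (@le_trans _ _ (1 + 1)) => //; apply: lerD; [apply: cnorm1_le1|apply: sqrt_step_le1].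
Qed.

Let sB k : cnorm (a ^+ 2 - s k ^+ 2) <= 4 / k.+2%:R.
Proof. by have := sqrt_approx_sqr_le a21 k; rewrite subKr -cnormN opprB. Qed.

Let s_f k : star (excess k) = excess k.
Proof. by rewrite starD ss sa. Qed.

Let f3 k : cnorm (excess k) <= 3.
Proof.
apply: le_trans (cnormD _ _) _; apply: (@le_trans _ _ (2 + 1%:R)); last by rewrite -natrD.
exact: lerD.
Qed.

Let comm_Tf k : GRing.comm T (excess k).
Proof. by apply: commrD => //; apply: comm_s. Qed.

Lemma excess_cauchy : cnorm_cauchy excess.
Proof.
move=> e e0; have [n0 hn0] := harmonic_small 4 e0; exists n0 => m n hm hn.
rewrite /excess [s n + a]addrC addrKA.
have -> : s m - s n = (s m - s n0) - (s n - s n0).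
  by move: (s m) (s n) (s n0) => u v w; rewrite opprB addrA subrK.
apply: le_lt_trans (cnormB _ _) _.
apply: le_lt_trans (lerD (sqrt_approx_cauchy a21 hm) (sqrt_approx_cauchy a21 hn)) _.
by rewrite -mulrDl -natrD hn0.
Qed.

(** Multiplication by [T ^+ 2] expands by the factor [rho] where [a] is positive,
    up to the error of the square root approximation.  In detail, [T ^+ 2] is
    [rho + l ^+ 2 * a], and [a] may be replaced by the positive element [s k] in
    front of [excess k], since [(a - s k) * excess k = a ^+ 2 - s k ^+ 2]. *)
Lemma excess_moment_step k m :
  rho * psi ((T ^+ m * excess k) ^+ 2) - l ^+ 2 * (12 / k.+2%:R)
    <= psi ((T ^+ m.+1 * excess k) ^+ 2).
Proof.
set f := excess k; set z := T ^+ m * f.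
have cTf : GRing.comm (T ^+ m) f by apply/commr_sym/commrX/commr_sym/comm_Tf.
have cTz : GRing.comm T z by apply: commrM; [apply: commrX|apply: comm_Tf].
have sz : star z = z by rewrite starM s_f starX sT -cTf.
have csz : GRing.comm (s k) z.
  apply: commrM; first by apply: commrX; apply/commr_sym/comm_s.
  by apply: commrD => //; apply/commr_sym/comm_s.
have ca_s : GRing.comm a (s k) by apply: comm_s.
have caf : GRing.comm a f by apply: commrD.
have caT : GRing.comm (a - s k) (T ^+ (2 * m)).
  by apply/commrX/commr_sym/commrB => //; apply: comm_s.
have key : (T ^+ m.+1 * f) ^+ 2 = rho%:C *: z ^+ 2
    + (l ^+ 2)%:C *: (z * s k * z + T ^+ (2 * m) * ((a ^+ 2 - s k ^+ 2) * f)).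
  rewrite [T ^+ m.+1]exprS -mulrA -/z exprMn_comm // TTE mulrDl.
  rewrite -(scalerAl _ 1) -(scalerAl _ a) mul1r.
  congr (_ + _ *: _).
  (* The part [s k * z ^+ 2] is positive, and the rest is an error term. *)
  have -> : a * z ^+ 2 = s k * z ^+ 2 + (a - s k) * z ^+ 2.
    by rewrite -mulrDl addrCA subrr addr0.
  congr (_ + _).
    by rewrite expr2 mulrA csz.
  rewrite /z exprMn_comm // -exprM mulnC mulrA caT -mulrA; congr (_ * _).
  rewrite expr2 mulrA; congr (_ * _).
  rewrite /f /excess; move: (s k) (a) ca_s => u b cbu.
  by rewrite mulrDr !mulrBl -!expr2 cbu addrC addrA subrK.
rewrite key re_stateD re_stateZ lerD2l re_stateZ -mulrN.
apply: ler_wpM2l; first exact/ltW/exprn_gt0.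
rewrite re_stateD -[X in X <= _]add0r; apply: lerD.
  have := re_state_conj_ge0 phi_state z (sqrt_step_le1 a21 k) (ss k).
  by rewrite sz.
set w := _ * f; have cw : cnorm w <= 12 / k.+2%:R.
  have -> : 12 / k.+2%:R = 4 / k.+2%:R * 3 :> R by rewrite mulrAC -natrM.
  by apply: cnormM_le; [exact: sB|exact: f3].
suff : `|psi (T ^+ (2 * m) * w)| <= 12 / k.+2%:R by rewrite ler_norml => /andP[].
apply: le_trans cw; apply: re_state_mul_le => //.
- by rewrite starX sT.
- rewrite /w starM s_f starB !starX sa ss; apply/commr_sym/commr_sym.
  apply: commrB; apply/commrX/commr_sym => //.
  by apply: commrD => //; apply: commr_sym.
- apply/commr_sym/commrX/commr_sym/commrM; last exact: comm_Tf.
  by apply: commrB; apply: commrX => //; apply: comm_s.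
- by rewrite -exprM mulnC T_moments.
Qed.

(** The moments of [excess k] against powers of [T] stay bounded, which is
    incompatible with expansion by [rho] unless the first one is small. *)
Lemma excess_state_small k : psi (excess k ^+ 2) <= l ^+ 2 * 12 / (rho - 1) / k.+2%:R.
Proof.
have -> : l ^+ 2 * 12 / (rho - 1) / k.+2%:R = l ^+ 2 * (12 / k.+2%:R) / (rho - 1).
  by rewrite mulrAC mulrA.
have -> : excess k ^+ 2 = (T ^+ 0 * excess k) ^+ 2 by rewrite expr0 mul1r.
apply: (bounded_affine_growth (g := fun m => psi ((T ^+ m * excess k) ^+ 2))
  (C := 9) rho1 (excess_moment_step k)) => m.
set f := excess k.
have cTf : GRing.comm (T ^+ m) f by apply/commr_sym/commrX/commr_sym/comm_Tf.
rewrite exprMn_comm // -exprM mulnC; apply: le_trans (ler_norm _) _.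
apply: (@le_trans _ _ (cnorm (f ^+ 2))).
  apply: re_state_mul_le => //.
  - by rewrite starX sT.
  - by rewrite starX s_f.
  - exact/commrX/commr_sym/commrX/commr_sym/comm_Tf.
  - by rewrite -exprM mulnC T_moments.
rewrite cnorm_sa_sqr; last exact: s_f.
apply: (@le_trans _ _ (3 ^+ 2)); last by rewrite -natrX.
rewrite ler_pXn2r ?nnegrE ?cnorm_ge0 ?ler0n //.
exact: f3.
Qed.

(** By faithfulness [excess k] tends to [0], hence [1 + a] is a limit of elements
    [1 - s k] of norm at most [1].  So [- a = 1 - (1 + a)] has an approximate
    square root [r], and [T ^+ 2 + (l r) ^+ 2] is close to [rho]. *)
Lemma cnorm_sqr_le_of_faithful : faithful_state phi -> cnorm T ^+ 2 <= rho.
Proof.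
move=> /(_ excess excess_cauchy) faith.
have {faith} f0 : cnorm_cvg excess 0.
  apply: faith => e e0; set c := l ^+ 2 * 12 / (rho - 1).
  have [n0 hn0] := harmonic_small c e0; exists n0 => n hn.
  rewrite (state_sqrE phi_state) normc_def /= expr0n addr0 sqrtr_sqr ltcR.
  rewrite ger0_norm ?re_state_sqr_ge0 // s_f.
  exact: le_lt_trans (excess_state_small n) (hn0 n hn).
have x1 : cnorm (1 + a) <= 1.
  apply/ler_addgt0Pr => e e0; have [n /(_ n (leqnn n))] := f0 e e0.
  rewrite subr0 => fn; have -> : 1 + a = (1 - s n) + excess n.
    by rewrite /excess addrA subrK.
  by apply: le_trans (cnormD _ _) (lerD _ (ltW fn)); apply: sqrt_step_le1.
rewrite -subr_le0; apply: (@le0_harmonic _ _ (l ^+ 2 * 4)) => j.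
pose r := sqrt_approx (1 + a) j.
have cTr : GRing.comm T r.
  by apply: sqrt_approx_comm; apply: commrD => //; apply: commr1.
have sr : star r = r by apply: sqrt_approx_star; rewrite starD star1 sa.
have ra : cnorm (r ^+ 2 + a) <= 4 / j.+2%:R.
  by have := sqrt_approx_sqr_le x1 j; rewrite (_ : - (1 - _) = a) // opprB addrC addKr.
have sq : star (l%:C *: r) = l%:C *: r by rewrite starZr sr.
have cq : GRing.comm T (l%:C *: r) by rewrite /GRing.comm -scalerAl -scalerAr cTr.
have := cnorm_le_sum_sqr sT sq cq.
have -> : T ^+ 2 + (l%:C *: r) ^+ 2 = rho%:C *: 1 + (l ^+ 2)%:C *: (r ^+ 2 + a).
  by rewrite TTE exprZn -rmorphXn -addrA -scalerDr [a + _]addrC.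
move=> h; rewrite lerBlDl; apply: le_trans h _.
apply: le_trans (cnormD _ _) _; rewrite !cnormZr -mulrA.
have r0 : 0 < rho by apply: lt_trans rho1.
rewrite !gtr0_norm ?exprn_gt0 //; apply: lerD.
  by rewrite ler_piMr ?cnorm1_le1 // ltW.
by apply: ler_wpM2l => //; rewrite exprn_ge0 // ltW.
Qed.

End Faithful.

Lemma cnorm_le1_of_moments (R : realType) (B : preCStarAlgType R) (phi : {scalar B}) (T : B) :
  is_state phi -> faithful_state phi -> star T = T ->
  (forall m, re_state phi (T ^+ (2 * m)) <= 1) -> cnorm T <= 1.
Proof.
move=> sphi fphi sT T1.
rewrite -(@ler_pXn2r _ 2) ?nnegrE ?cnorm_ge0 // expr1n.
apply/ler_addgt0Pr => e e0; apply: (cnorm_sqr_le_of_faithful sphi) => //.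
by rewrite ltrDl.
Qed.

(** Rescaling [T] by [M + e] reduces to the bound [1], also when [M = 0]. *)
Lemma cnorm_le_of_moments (R : realType) (B : preCStarAlgType R) (phi : {scalar B})
    (T : B) (M : R) :
  is_state phi -> faithful_state phi -> star T = T -> 0 <= M ->
  (forall n, re_state phi (T ^+ n) <= M ^+ n) -> cnorm T <= M.
Proof.
move=> sphi fphi sT M0 TM; apply/ler_addgt0Pr => e e0.
have Me : 0 < M + e by rewrite ltr_wpDl.
have -> : T = (M + e)%:C *: (((M + e)^-1)%:C *: T).
  by rewrite scalerA -rmorphM mulfV ?gt_eqF // scale1r.
rewrite cnormZr gtr0_norm // -[X in _ <= X]mulr1 ler_pM2l //.
apply: (cnorm_le1_of_moments sphi fphi); first by rewrite starZr sT.
move=> m; rewrite exprZn -rmorphXn re_stateZ exprVn ler_pdivrMl ?exprn_gt0 // mulr1.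
apply: le_trans (TM _) _.
rewrite lerXn2r ?nnegrE // ?lerDl ltW //.
Qed.

(** * Moments, cumulants and partitions *)

Section MobiusInversion.
Context {d : Order.disp_t} {T : finPOrderType d}.
Implicit Types x y z : T.

Lemma sum_mobius x y : (x <= y)%O ->
  \sum_(z : T | (x <= z)%O && (z <= y)%O) mobius x z = (x == y)%:R.
Proof.
move=> xy; rewrite (bigD1 y) /=; last by rewrite xy lexx.
rewrite [X in X + _]mobiusE xy; case: eqP => [<-|/eqP nxy].
  rewrite big1 ?addr0 // => z /andP[/andP[xz zx]] nzx.
  by move: nzx; rewrite eq_le xz zx.
rewrite addrC; apply/eqP; rewrite subr_eq0; apply/eqP; apply: eq_bigl => z.
by rewrite -andbA lt_neqAle [(z != y) && _]andbC.
Qed.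

(** Moebius inversion; for set partitions, it expresses moments by cumulants. *)
Lemma sum_mobius_transform (V : pzRingType) (f : T -> V) y :
  \sum_(z | (z <= y)%O) \sum_(x | (x <= z)%O) f x * (mobius x z)%:~R = f y.
Proof.
rewrite (exchange_big_dep (fun x => (x <= y)%O)) /=; last first.
  by move=> z x zy xz; apply: le_trans zy.
rewrite (eq_bigr (fun x => f x * (x == y)%:R)) => [|x xy].
  rewrite (bigD1 y) //= eqxx mulr1 big1 ?addr0 // => x /andP[_ /negPf ->].
  by rewrite mulr0.
rewrite -mulr_sumr -(rmorph_sum (intmul 1)) /= (eq_bigl _ _ (fun z => andbC _ _)).
by rewrite sum_mobius //; case: eqP.
Qed.

End MobiusInversion.

Section Partitions.
Variable n : nat.
Implicit Types (p q : set_partition n) (i j : 'I_n).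

Lemma mem_cover_blocks p i : i \in cover (blocks p).
Proof. by have /and3P[/eqP -> _ _] := blocksP p; rewrite inE. Qed.

Lemma trivIset_blocks p : trivIset (blocks p).
Proof. by have /and3P[] := blocksP p. Qed.

Lemma eq_block_number p i j : (block_number p i == block_number p j) = same_block p i j.
Proof.
have memB k : pblock (blocks p) k \in enum (blocks p).
  by rewrite mem_enum pblock_mem ?mem_cover_blocks.
apply/eqP/eqP => [ij|ij]; last by rewrite /block_number ij.
by rewrite -(nth_index set0 (memB i)) -/(block_number p i) ij nth_index.
Qed.

Lemma finer_same_block p q i j : (p <= q)%O -> same_block p i j -> same_block q i j.
Proof.
move=> /'forall_implyP pq; rewrite /same_block !eq_pblock ?trivIset_blocks ?mem_cover_blocks //.
move=> ij.
have /pq/exists_inP[C qC /subsetP BC] : pblock (blocks p) i \in blocks p.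
  exact/pblock_mem/mem_cover_blocks.
rewrite (def_pblock (trivIset_blocks q) qC (BC _ _)) ?BC //.
by rewrite mem_pblock mem_cover_blocks.
Qed.

Definition kernel_partition (h : 'I_n -> nat) : set_partition n :=
  SetPartition (preim_partitionP h [set: 'I_n]).

Lemma same_block_kernel h i j : same_block (kernel_partition h) i j = (h i == h j).
Proof.
rewrite /same_block eq_pblock ?trivIset_blocks ?mem_cover_blocks //.
rewrite pblock_equivalence_partition ?inE //.
by split => // /eqP ->.
Qed.

Definition has_singleton p := [exists i, [forall j, same_block p i j ==> (j == i)]].

Lemma has_singletonP p :
  reflect (exists i, forall j, same_block p i j -> j = i) (has_singleton p).
Proof.
apply: (iffP existsP) => [[i /forallP h]|[i h]]; exists i.
  by move=> j ij; apply/eqP; have := h j; rewrite ij.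
by apply/forallP => j; apply/implyP => /h ->.
Qed.

End Partitions.

(** By induction on [l]: each new index is corrected by a transposition, which
    does not disturb the earlier ones. *)
Lemma extend_to_bijection (T : eqType) (f g : T -> nat) (l : seq T) :
  (forall i j, (f i == f j) = (g i == g j)) ->
  exists2 s : nat -> nat, bijective s & {in l, forall i, s (f i) = g i}.
Proof.
move=> fg; elim: l => [|i l [s bs sl]]; first by exists id => //; exists id.
have [/hasP[j jl /eqP fij]|nfi] := boolP (has (fun j => f i == f j) l).
  exists s => // k; rewrite inE => /orP[/eqP -> |/sl //].
  by rewrite fij sl //; apply/esym/eqP; rewrite -fg fij.
(* The transposition of [s (f i)] and [g i]. *)
pose t u := if u == s (f i) then g i else if u == g i then s (f i) else u.
have tK : involutive t.
  move=> u; rewrite /t; have [->|u1] := eqVneq u (s (f i)).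
    by rewrite eqxx; case: eqVneq => [->|].
  have [->|u2] := eqVneq u (g i); first by rewrite eqxx.
  by rewrite (negPf u1) (negPf u2).
exists (t \o s); first by apply: bij_comp => //; exists t.
move=> k; rewrite inE /t /= => /orP[/eqP ->|kl]; first by rewrite eqxx.
have nfk : f i != f k by apply: contra nfi => h; apply/hasP; exists k.
rewrite (sl k kl) -(sl k kl) (inj_eq (bij_inj bs)) eq_sym (negPf nfk) sl //.
by rewrite eq_sym -fg (negPf nfk).
Qed.

Section Moments.
Variables (R : realType) (A : preCStarAlgType R) (phi : {scalar A}).
Variable E : exchangeability_system phi.

(** By exchangeability, only the level sets of the index map matter. *)
Lemma moment_kernel n (h : 'I_n -> nat) (X : 'I_n -> A) :
  exch_state E (\prod_(i < n) emb E (h i) (X i)) =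
  partitioned_moment E (kernel_partition h) X.
Proof.
have [i j|s bs sP] := @extend_to_bijection _ (block_number (kernel_partition h)) h (enum 'I_n).
  by rewrite eq_block_number same_block_kernel.
rewrite /partitioned_moment [RHS](exchangeable _ _ _ bs); congr (exch_state E _).
by apply: eq_bigr => i _; rewrite sP ?mem_enum.
Qed.

Hypothesis E_noncrossing : noncrossing_system E.
Hypothesis E_weak_singleton : weak_singleton_condition E.
Variable X : A.
Hypothesis X_selfadjoint : star X = X.
Hypothesis X_centered : exch_state E (emb E 1 X * emb E 2 X) = 0.

Lemma moment_singleton n (p : set_partition n) :
  has_singleton p -> partitioned_moment E p (fun=> X) = 0.
Proof.
move=> /has_singletonP[i pi]; apply: (E_weak_singleton (j := i)).
  by move=> k /eqP; rewrite eq_block_number => h; apply: pi; rewrite /same_block eq_sym.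
by rewrite -emb_star X_selfadjoint.
Qed.

Lemma cumulant_singleton n (p : set_partition n) :
  has_singleton p -> partitioned_cumulant E p (fun=> X) = 0.
Proof.
move=> /has_singletonP[i pi]; apply: big1 => q qp; rewrite moment_singleton ?mul0r //.
by apply/has_singletonP; exists i => j qij; apply: pi; apply: finer_same_block qij.
Qed.

(** Only such partitions have nonzero cumulants, and the moment is a sum of the
    cumulants of the partitions finer than the kernel of [h]. *)
Lemma moment_neq0_noncrossing n (h : 'I_n -> nat) :
  exch_state E (\prod_(i < n) emb E (h i) X) != 0 ->
  exists p : set_partition n, [/\ noncrossing p, ~~ has_singleton p &
    forall i j, same_block p i j -> h i = h j].
Proof.
rewrite (moment_kernel h (fun=> X)).
rewrite -(sum_mobius_transform (fun p => partitioned_moment E p (fun=> X))).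
move=> nz.
have /existsP[p /and3P[ph ncp sp]] :
    [exists p, [&& (p <= kernel_partition h)%O, noncrossing p & ~~ has_singleton p]].
  apply: contra_neqT nz => /existsPn np; apply: big1 => p ph.
  have := np p; rewrite ph /= negb_and negbK => /orP[ncp|sp].
    exact: E_noncrossing.
  exact: cumulant_singleton.
exists p; split=> // i j /(finer_same_block ph).
by rewrite same_block_kernel => /eqP.
Qed.

End Moments.

(** * Noncrossing words and a pushdown automaton *)

Section Stack.

(** The stack [s] lists the letters of the blocks that are open, innermost block
    first.  Reading a letter opens a new block or, if the letter agrees with the
    top of the stack, continues or closes the innermost block.  Closing requires a
    letter of its own, so no block is a singleton. *)
Fixpoint stack_accepts (s w : seq nat) : bool :=
  if w is a :: w' then
    stack_accepts (a :: s) w' ||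
    (if s is b :: s' then (b == a) && (stack_accepts s w' || stack_accepts s' w') else false)
  else nilp s.

Lemma stack_accepts_map f s w : stack_accepts s w -> stack_accepts (map f s) (map f w).
Proof.
elim: w s => [|a w IH] s; first by case: s.
move=> /= /orP[/IH -> //|]; case: s => [//|b s] /andP[/eqP -> ].
by rewrite /= eqxx => /orP[/IH/= ->|/IH ->]; rewrite !orbT.
Qed.

(** Here the letters are the names of the blocks.  The word [rev s ++ w] consists of
    one letter for each open block and the part still to be read, and stays
    noncrossing with every letter occurring at least twice.  If a letter already
    on the stack is read, then it is on top: otherwise the letter on top, which
    has to occur in [w] again, would cross it. *)
Lemma stack_accepts_noncrossing s w :
  uniq s -> {in rev s ++ w, forall a, (2 <= count_mem a (rev s ++ w))%N} ->
  (forall a b, subseq [:: a; b; a; b] (rev s ++ w) -> a = b) ->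
  stack_accepts s w.
Proof.
elim: w s => [|a w IH] s us.
  rewrite cats0 => c2 _ /=; case: s us c2 => [//|b s] us c2.
  have := c2 b; rewrite mem_rev mem_head count_rev => /(_ isT).
  by rewrite count_uniq_mem // mem_head.
move=> c2 nc /=; have [as_|nas] := boolP (a \in s); last first.
  by rewrite IH //= ?nas ?rev_cons ?cat_rcons.
case: s us c2 nc as_ => [//|b s] us c2 nc as_.
have ba : b = a.
  apply/eqP; apply: contraTT as_ => nba.
  rewrite inE eq_sym (negPf nba) /=; apply/negP => ains.
  have bw : b \in w.
    have := c2 b; rewrite mem_cat mem_rev mem_head => /(_ isT).
    rewrite count_cat count_rev count_uniq_mem // mem_head /= eq_sym (negPf nba).
    by rewrite -has_pred1 has_count /=; case: (count _ w).
  move/eqP: nba; apply; apply/esym/(nc a b).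
  rewrite rev_cons cat_rcons; have -> : [:: a; b; a; b] = [:: a] ++ [:: b; a; b] by [].
  apply: cat_subseq; first by rewrite sub1seq mem_rev.
  by rewrite /= !eqxx sub1seq.
subst b; rewrite eqxx /=; apply/orP; right.
have [aw|naw] := boolP (a \in w).
  apply/orP; left; apply: IH => //.
    move=> c cin; have := c2 c; rewrite mem_cat in_cons orbCA -mem_cat cin orbT => /(_ isT).
    rewrite !count_cat !count_rev /=; case: eqVneq => [<-|_] //.
    move: aw; rewrite -has_pred1 has_count => aw _.
    by rewrite add1n addSn ltnS addn_gt0 aw orbT.
  move=> c d sub; apply: nc; apply: subseq_trans sub _.
  by rewrite cat_subseq // subseq_cons.
apply/orP; right; move: us => /= /andP[nas us]; apply: IH => //.
  move=> c cin.
  have nca : c != a.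
    by apply: contraNneq nas => ca; move: cin; rewrite ca mem_cat mem_rev (negPf naw) orbF.
  have := c2 c; rewrite rev_cons cat_rcons mem_cat !in_cons.
  rewrite mem_cat in cin.
  have -> : (c \in rev s) || [|| c == a, c == a | c \in w].
    by case/orP: cin => ->; rewrite ?orbT.
  by rewrite !count_cat /= eq_sym (negPf nca) => /(_ isT).
move=> c d sub; apply: nc; apply: subseq_trans sub _.
rewrite rev_cons cat_rcons; apply: cat_subseq => //.
exact: subseq_trans (subseq_cons _ _) (subseq_cons _ _).
Qed.

(** The word of block numbers is accepted, and [h] is a recolouring of it. *)
Lemma stack_accepts_partition n (p : set_partition n) (h : 'I_n -> nat) :
  noncrossing p -> ~~ has_singleton p ->
  (forall i j, same_block p i j -> h i = h j) -> stack_accepts [::] [seq h i | i <- enum 'I_n].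
Proof.
move=> ncp sp ph; pose v := [seq block_number p i | i <- enum 'I_n].
(* The colour of a block number is read off its first occurrence in [v]. *)
pose f l := nth 0%N [seq h i | i <- enum 'I_n] (index l v).
have fE i : f (block_number p i) = h i.
  have iv : block_number p i \in v by rewrite map_f ?mem_enum.
  have i0 : (index (block_number p i) v < size (enum 'I_n))%N.
    by rewrite -index_mem size_map in iv.
  rewrite /f (nth_map i) //; apply: ph; rewrite -eq_block_number.
  by rewrite -[X in X == _](nth_map i 0%N (block_number p)) // nth_index.
have -> : [seq h i | i <- enum 'I_n] = map f v.
  by rewrite /v -[RHS]map_comp; apply: eq_map => i /=; rewrite fE.
rewrite -[[::]]/(map f [::]); apply: stack_accepts_map; apply: stack_accepts_noncrossing => //=.
  move=> _ /mapP[i _ ->].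
  have /existsP[j] : [exists j, same_block p i j && (j != i)].
    apply: contraNT sp => /existsPn hi; apply/has_singletonP; exists i => j ij.
    by have := hi j; rewrite ij /= negbK => /eqP.
  move=> /andP[ij nji]; rewrite count_map.
  rewrite -size_filter; apply: (@uniq_leq_size _ [:: i; j]); first by rewrite /= inE eq_sym nji.
  move=> k; rewrite !inE mem_filter mem_enum andbT => /orP[] /eqP -> /=.
    exact: eqxx.
  by rewrite eq_block_number /same_block eq_sym.
move=> a b /subseqP[m _]; rewrite -map_mask.
have : sorted ltn (map val (mask m (enum 'I_n))).
  rewrite map_mask val_enum_ord; apply: sorted_mask (iota_ltn_sorted _ _).
  exact: ltn_trans.
case: (mask m _) => [|i [|j [|k [|l []]]]] //= /and4P[ij jk kl _] [-> -> ki lj].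
apply/eqP; rewrite eq_block_number; apply: contraNT ncp => nij.
apply/existsP; exists i; apply/existsP; exists j; apply/existsP; exists k; apply/existsP; exists l.
by rewrite ij jk kl nij -!eq_block_number ki lj !eqxx.
Qed.

End Stack.

(** * Counting the accepted words *)

Section WordSums.
Variable N : nat.

(** The sum of [F] over the words of length [n] in the letters [1, ..., N], by
    recursion on the first letter, in step with the automaton. *)
Fixpoint word_sum (V : nmodType) (n : nat) (F : seq nat -> V) : V :=
  if n is n'.+1 then \sum_(1 <= a < N.+1) word_sum n' (fun w => F (a :: w))
  else F [::].

Lemma word_sum_morph (V W : nmodType) (f : V -> W) n F :
  f 0 = 0 -> {morph f : x y / x + y} -> f (word_sum n F) = word_sum n (f \o F).
Proof.
move=> f0 fD; elim: n F => [//|n IH] F /=.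
by rewrite (big_morph f fD f0); apply: eq_bigr => a _; rewrite IH.
Qed.

Lemma eq_word_sum (V : nmodType) n (F G : seq nat -> V) : F =1 G -> word_sum n F = word_sum n G.
Proof.
elim: n F G => [|n IH] F G FG /=; first exact: FG.
by apply: eq_bigr => a _; apply: IH => w.
Qed.

Lemma ler_word_sum (R : realType) n (F G : seq nat -> R) :
  (forall w, size w = n -> F w <= G w) -> word_sum n F <= word_sum n G.
Proof.
elim: n F G => [|n IH] F G FG /=; first exact: FG.
by apply: ler_sum => a _; apply: IH => w sw; apply: FG; rewrite /= sw.
Qed.

Lemma expr_word_sum (B : pzRingType) (x : nat -> B) n :
  (\sum_(1 <= a < N.+1) x a) ^+ n = word_sum n (fun w => \prod_(a <- w) x a).
Proof.
elim: n => [|n IH] /=; first by rewrite big_nil.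
rewrite exprS IH mulr_suml; apply: eq_bigr => a _.
rewrite (word_sum_morph _ _ (mulr0 _) (mulrDr (x a))).
by apply: eq_word_sum => w /=; rewrite big_cons.
Qed.

Lemma word_sumD (V : nmodType) n (F G : seq nat -> V) :
  word_sum n (fun w => F w + G w) = word_sum n F + word_sum n G.
Proof.
elim: n F G => [//|n IH] F G /=; rewrite -big_split.
by apply: eq_bigr => a _; rewrite IH.
Qed.

Variable R : realType.
Hypothesis N_gt0 : (0 < N)%N.
Let t : R := Num.sqrt N%:R.

(** Runs of the automaton are Motzkin paths whose height is the size of the stack:
    each of the [N] letters opens a block, and only one letter continues or closes
    the innermost one.  The weight [t ^- h] at height [h] is an eigenvector of the
    transfer operator, away from height [0], with eigenvalue
    [N / t + 1 + t = 1 + 2 * t]. *)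
Lemma word_sum_accepts n s :
  word_sum n (fun w => (stack_accepts s w)%:R : R) <= (1 + 2 * t) ^+ n / t ^+ size s.
Proof.
have t0 : 0 < t by rewrite sqrtr_gt0 ltr0n.
have r0 : 0 < 1 + 2 * t by rewrite ltr_wpDr // mulr_ge0 // ltW.
have NE : N%:R = t ^+ 2 by rewrite sqr_sqrtr ?ler0n.
elim: n s => [|n IH] s.
  rewrite /= expr0 div1r; case: s => [|b s] /=; first by rewrite invr1.
  by rewrite invr_ge0 exprn_ge0 // ltW.
pose r := (1 + 2 * t) ^+ n; have rn0 : 0 <= r by rewrite exprn_ge0 // ltW.
pose top a : R := (ohead s == Some a)%:R.
have stepP a w : (stack_accepts s (a :: w))%:R <= (stack_accepts (a :: s) w)%:R
    + top a * ((stack_accepts s w)%:R + (stack_accepts (behead s) w)%:R) :> R.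
  rewrite /top /=; case: (stack_accepts (a :: s) w); first by rewrite lerDl mulr_ge0 ?addr_ge0.
  rewrite add0r; case: (s) => [|b s'] /=; first by rewrite mulr_ge0 ?addr_ge0.
  rewrite (inj_eq Some_inj); case: eqP => _ /=; last by rewrite mul0r.
  by rewrite mul1r -natrD ler_nat; case: (stack_accepts _ _).
(* At most one letter continues or closes the innermost block. *)
have tops : \sum_(1 <= a < N.+1) top a <= (0 < size s)%:R.
  rewrite /top; case: (s) => [|b s'] /=; first by rewrite big1.
  rewrite -natr_sum ler_nat -big_mkcond /= sum1_count.
  rewrite (@eq_count _ _ (pred1 b)); first by rewrite count_uniq_mem ?iota_uniq ?leq_b1.
  by move=> a /=; rewrite (inj_eq Some_inj) eq_sym.
apply: (@le_trans _ _ (\sum_(1 <= a < N.+1)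
    (r / t ^+ (size s).+1 + top a * (r / t ^+ size s + r / t ^+ (size s).-1)))).
  apply: ler_sum => a _; apply: le_trans (ler_word_sum (fun w _ => stepP a w)) _.
  rewrite word_sumD lerD ?(IH (a :: s)) //.
  rewrite -(word_sum_morph _ _ (mulr0 _) (mulrDr (top a))).
  rewrite ler_wpM2l ?ler0n // word_sumD lerD ?IH // -size_behead IH //.
rewrite big_split /= sumr_const_nat -mulr_suml -[_ *+ (_ - 1)]mulr_natl subn1 /= NE.
apply: (@le_trans _ _ (t ^+ 2 * (r / t ^+ (size s).+1)
    + (0 < size s)%:R * (r / t ^+ size s + r / t ^+ (size s).-1))).
  by rewrite lerD2l ler_wpM2r // addr_ge0 // mulr_ge0 // invr_ge0 exprn_ge0 // ltW.
rewrite [(1 + 2 * t) ^+ _]exprS -/r; case: (size s) => [|k] /=.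
  rewrite mul0r addr0 expr1 expr0 divr1.
  have -> : t ^+ 2 * (r / t) = t * r by field; rewrite gt_eqF.
  by apply: ler_wpM2r => //; lra.
rewrite mul1r !exprS !invfM le_eqVlt; apply/orP; left; apply/eqP.
by field; rewrite ?expf_neq0 gt_eqF.
Qed.

End WordSums.

(** * The norm of the sum *)

(** A homomorphism between incomplete algebras need not be contractive; this one
    preserves the state, hence the moments. *)
Lemma cnorm_emb (R : realType) (A : preCStarAlgType R) (phi : {scalar A})
    (E : exchangeability_system phi) (k : nat) (X : A) :
  is_state phi -> faithful_state (exch_state E) -> star X = X ->
  cnorm (emb E k X) <= cnorm X.
Proof.
move=> sphi fE sX.
apply: (cnorm_le_of_moments (exch_stateP E) fE); rewrite ?cnorm_ge0 //.
  by rewrite -emb_star sX.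
move=> n; rewrite -rmorphXn /re_state emb_state -/(re_state phi _).
apply: le_trans (ler_norm _) (le_trans (re_state_norm sphi _) _).
exact: cnormX.
Qed.

Theorem proposition3p1 (R : realType) (A : preCStarAlgType R) (phi : {scalar A})
  (phi_state : is_state phi) (E : exchangeability_system phi)
  (E_noncrossing : noncrossing_system E)
  (E_weak_singleton : weak_singleton_condition E)
  (E_faithful : faithful_state (exch_state E))
  (X : A) (X_selfadjoint : star X = X)
  (X_centered : exch_state E (emb E 1 X * emb E 2 X) = 0)
  (N : nat) (N_ge2 : (2 <= N)%N) :
  cnorm (\sum_(1 <= i < N.+1) emb E i X) <=
    2 * Num.sqrt N%:R / (1 - 1 / Num.sqrt N%:R) * cnorm X.
Proof.
have N_gt0 : (0 < N)%N by apply: ltnW.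
set t : R := Num.sqrt N%:R; set M := cnorm X.
have t0 : 0 < t by rewrite sqrtr_gt0 ltr0n.
have M0 : 0 <= M := cnorm_ge0 X.
(* The stated constant exceeds [1 + 2 * t], for it is [2 * t + 2 + 2 / (t - 1)]. *)
suff bound : cnorm (\sum_(1 <= i < N.+1) emb E i X) <= (1 + 2 * t) * M.
  apply: le_trans bound _; apply: ler_wpM2r => //.
  have t1 : 1 < t by rewrite -sqrtr1 ltr_sqrt ?ltr0n // ltr1n.
  have u0 : 0 < t^-1 by rewrite invr_gt0.
  have ut : t * t^-1 = 1 by rewrite mulfV ?gt_eqF.
  have u1 : t^-1 < 1 by rewrite invf_lt1.
  rewrite div1r ler_pdivlMr ?subr_gt0 //; nra.
apply: (cnorm_le_of_moments (exch_stateP E) E_faithful).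
- rewrite (big_morph _ (@starD _ _) (@star0 _ _)).
  by apply: eq_bigr => i _; rewrite -emb_star X_selfadjoint.
- by rewrite mulr_ge0 // addr_ge0 // mulr_ge0 // ltW.
move=> n; rewrite expr_word_sum.
rewrite (word_sum_morph _ _ (f := re_state (exch_state E))); last exact: re_stateD.
  2: by rewrite /re_state linear0.
apply: (@le_trans _ _ (word_sum N n (fun w => M ^+ n * (stack_accepts [::] w)%:R))); last first.
  rewrite -(word_sum_morph _ _ _ (mulr0 _) (mulrDr (M ^+ n))) exprMn mulrC ler_wpM2r ?exprn_ge0 //.
  by have := word_sum_accepts R N_gt0 n [::]; rewrite expr0 divr1.
apply: ler_word_sum => w sw /=.
have prodE : \prod_(a <- w) emb E a X = \prod_(i < n) emb E (nth 0%N w i) X.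
  by rewrite (big_nth 0%N) big_mkord sw.
have [pw|npw] := boolP (stack_accepts [::] w).
  rewrite mulr1; apply: le_trans (ler_norm _) (le_trans (re_state_norm (exch_stateP E) _) _).
  rewrite -sw; elim: (w) => [|a v IH] /=; first by rewrite big_nil expr0 cnorm1_le1.
  by rewrite big_cons exprS; apply: cnormM_le => //; apply: cnorm_emb.
rewrite mulr0 /re_state prodE.
suff -> : exch_state E (\prod_(i < n) emb E (nth 0%N w i) X) = 0 by [].
apply: contraNeq npw.
move=> /(moment_neq0_noncrossing E_noncrossing E_weak_singleton X_selfadjoint X_centered).
move=> [p [ncp sp ph]]; have := stack_accepts_partition ncp sp ph.
rewrite (_ : [seq _ | i <- enum 'I_n] = w) //.
by rewrite -[LHS]/(map (nth 0%N w \o val) _) map_comp val_enum_ord -sw map_nth_iota0 ?take_size.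
Qed.
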